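(* A matrix $A \in M_{2n\times 2n}(\mathbb{C})$ is normal, skew-Hamiltonian and symplectic diagonalizable if and only if $A = N + N^\star$ for some normal matrix $N \in M_{2n\times 2n}(\mathbb{C})$ satisfying $NN^\star = N^\star N = 0$.
   Context: $M_{2n\times 2n}(\mathbb{C})$ is the space of complex $2n\times 2n$ matrices and $A^H=\overline{A}^T$ is the Hermitian transpose. $A$ is normal if $A^HA=AA^H$. $J_{2n} = \begin{bmatrix} 0 & I_n \\ -I_n & 0\end{bmatrix}$. For $X \in M_{2n\times 2n}(\mathbb{C})$, $X^\star := J_{2n}^{-1}X^HJ_{2n} = J_{2n}^T X^H J_{2n}$ is the adjoint of $X$ with respect to the form $[x,y]=x^HJ_{2n}y$. $A$ is skew-Hamiltonian if $A^\star=A$. A matrix $S \in M_{2n\times 2n}(\mathbb{C})$ is symplectic if $S^H J_{2n} S = J_{2n}$. $A$ is symplectic diagonalizable if there is a symplectic matrix $S$ such that $S^{-1}AS$ is diagonal. *)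

(* Defs.v *)
From HB Require Import structures.
From mathcomp Require Import all_boot all_order all_algebra.
From mathcomp Require Import sesquilinear spectral.
From mathcomp Require Import reals complex.

Set Implicit Arguments.
Unset Strict Implicit.
Unset Printing Implicit Defensive.

Import Order.TTheory GRing.Theory Num.Theory.
Local Open Scope ring_scope.
Local Open Scope sesquilinear_scope.
Local Open Scope complex_scope.

(* C is rendered as R[i], for R a realType. *)
Section SymplecticForm.
Variables (R : realType) (n : nat).

(* 2n x 2n matrices have type 'M_(n + n), which makes the n x n block
   decomposition available. *)
Definition Jmx : 'M[R[i]]_(n + n) := block_mx 0 1%:M (- 1%:M) 0.

Definition star (X : 'M[R[i]]_(n + n)) : 'M[R[i]]_(n + n) :=
  invmx Jmx *m X ^t* *m Jmx.

Definition skew_hamiltonian (A : 'M[R[i]]_(n + n)) : Prop := star A = A.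

(* The form is sesquilinear, so this is the conjugate symplectic group, not
   the complex symplectic group Sp(2n, C). *)
Definition symplectic (S : 'M[R[i]]_(n + n)) : Prop :=
  S ^t* *m Jmx *m S = Jmx.

(* A symplectic S is invertible, hence invmx S is its actual inverse. *)
Definition symplectic_diagonalizable (A : 'M[R[i]]_(n + n)) : Prop :=
  exists S : 'M[R[i]]_(n + n),
    symplectic S /\ is_diag_mx (invmx S *m A *m S).

End SymplecticForm.

(* Main.v *)
(* Both properties are equivalent to A = U^H diag(a, a^H) U for some unitary
   symplectic U and normal a, that is, to the existence of a Lagrangian subspace
   W (of dimension n, with JW orthogonal to W) that reduces A.
   If S diagonalizes A symplectically, W is spanned by the first n columns of S:
   it is A-invariant, hence reducing since A is normal.
   If A = N + N* with N = [N1 N2] normal and N N* = 0, then N J N^H = 0, so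
   X = N1 + iN2 and Y = N1 - iN2 have equal Gram matrices X X^H = Y Y^H. Hence
   Y = XV for a unitary V, and N factors through the Lagrangian row space of
   [(1 + V)/2, -i(1 - V)/2]. *)
Require Import Defs.
From mathcomp Require Import all_boot all_order all_algebra.
From mathcomp Require Import sesquilinear spectral.
From mathcomp Require Import reals complex ring.

Set Implicit Arguments.
Unset Strict Implicit.
Unset Printing Implicit Defensive.

Import Order.TTheory GRing.Theory Num.Theory.
Local Open Scope ring_scope.
Local Open Scope sesquilinear_scope.

(** * Conjugate transposes: normality, orthonormal rows and Gram matrices *)

Section ConjugateTranspose.
Variable C : numClosedFieldType.

Lemma trmxC_mul m n p (A : 'M[C]_(m, n)) (B : 'M_(n, p)) :
  (A *m B)^t* = B^t* *m A^t*.
Proof. by rewrite trmx_mul map_mxM. Qed.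

Lemma trmxCD m n (A B : 'M[C]_(m, n)) : (A + B)^t* = A^t* + B^t*.
Proof. by rewrite linearD map_mxD. Qed.

Lemma trmxCN m n (A : 'M[C]_(m, n)) : (- A)^t* = - A^t*.
Proof. by rewrite linearN map_mxN. Qed.

Lemma trmxCZ m n a (A : 'M[C]_(m, n)) : (a *: A)^t* = a^* *: A^t*.
Proof. by rewrite linearZ map_mxZ. Qed.

Lemma trmxC0 m n : (0 : 'M[C]_(m, n))^t* = 0.
Proof. by rewrite trmx0 map_mx0. Qed.

Lemma trmxC1 n : (1%:M : 'M[C]_n)^t* = 1%:M.
Proof. by rewrite trmx1 map_mx1. Qed.

Lemma trmxC_row m n p (A : 'M[C]_(m, n)) (B : 'M_(m, p)) :
  (row_mx A B)^t* = col_mx (A^t*) (B^t*).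
Proof. by rewrite tr_row_mx map_col_mx. Qed.

Lemma trmxC_col m n p (A : 'M[C]_(m, n)) (B : 'M_(p, n)) :
  (col_mx A B)^t* = row_mx (A^t*) (B^t*).
Proof. by rewrite tr_col_mx map_row_mx. Qed.

Lemma trmxC_block m1 m2 n1 n2 (A : 'M[C]_(m1, n1)) (B : 'M_(m1, n2))
    (D : 'M_(m2, n1)) (E : 'M_(m2, n2)) :
  (block_mx A B D E)^t* = block_mx (A^t*) (D^t*) (B^t*) (E^t*).
Proof. by rewrite tr_block_mx map_block_mx. Qed.

(** The trace is the sum of the squared moduli of the entries. *)
Lemma mxtrace_mul_trmxC_eq0 m n (A : 'M[C]_(m, n)) :
  \tr (A *m A^t*) = 0 -> A = 0.
Proof.
have ge0 i j : 0 <= A i j * (A i j)^* by exact: mul_conjC_ge0.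
rewrite /mxtrace => /eqP; rewrite psumr_eq0 => [/allP trA0|i _]; last first.
  by rewrite mxE sumr_ge0 // => j _; rewrite !mxE.
apply/matrixP=> i j; have := trA0 i (mem_index_enum i).
rewrite mxE psumr_eq0 => [/allP /(_ j (mem_index_enum j))|k _]; rewrite !mxE //.
by rewrite /= mul_conjC_eq0 => /eqP.
Qed.

Lemma mul_trmxC_eq0 m n (A : 'M[C]_(m, n)) : A *m A^t* = 0 -> A = 0.
Proof. by move=> A0; apply: mxtrace_mul_trmxC_eq0; rewrite A0 mxtrace0. Qed.

Lemma normalmx_conj n (U A : 'M[C]_n) :
  U \is unitarymx -> A \is normalmx -> U *m A *m U^t* \is normalmx.
Proof.
move=> Uu /normalmxP nA; apply/normalmxP.
rewrite !trmxC_mul trmxCK !mulmxA !(mulmxKtV _ Uu) //.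
by rewrite -(mulmxA U) nA mulmxA.
Qed.

Lemma unitarymx_conjK n (U A : 'M[C]_n) :
  U \is unitarymx -> U^t* *m (U *m A *m U^t*) *m U = A.
Proof.
move=> /unitarymxP /mulmx1C UtU.
by rewrite !mulmxA UtU mul1mx -mulmxA UtU mulmx1.
Qed.

Lemma normalmx_block_diag m n (A : 'M[C]_m) (B : 'M[C]_n) :
  block_mx A 0 0 B \is normalmx = (A \is normalmx) && (B \is normalmx).
Proof.
apply/normalmxP/andP => [|[/normalmxP nA /normalmxP nB]].
  rewrite trmxC_block !trmxC0 !mulmx_block !(mulmx0, mul0mx, addr0, add0r).
  by case/eq_block_mx => /normalmxP nA _ _ /normalmxP.
rewrite trmxC_block !trmxC0 !mulmx_block !(mulmx0, mul0mx, addr0, add0r).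
by rewrite nA nB.
Qed.

Lemma normalmx_block_trig m n (A : 'M[C]_m) (B : 'M[C]_(m, n)) (D : 'M[C]_n) :
  block_mx A B 0 D \is normalmx -> B = 0.
Proof.
move=> /normalmxP; rewrite trmxC_block !trmxC0 !mulmx_block.
rewrite !(mulmx0, mul0mx, addr0, add0r) => /eq_block_mx [eqA _ _ _].
apply: mxtrace_mul_trmxC_eq0; apply: (@addrI _ (\tr (A *m A^t*))).
by rewrite -linearD eqA addr0 mxtrace_mulC.
Qed.

(** For a rectangular matrix, [unitarymx] means orthonormal rows. Gram-Schmidt on the kernel of
    [Q^t*] supplies [P], and the last identity is unitarity of the stacked square matrix. *)
Lemma unitarymx_complement k n (Q : 'M[C]_(k, n)) : Q \is unitarymx ->
  exists P : 'M[C]_(n - k, n),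
    [/\ P \is unitarymx, Q *m P^t* = 0 & Q^t* *m Q + P^t* *m P = 1%:M].
Proof.
move=> Qu; have rkQ := mxrank_unitary Qu.
have le_kn : (k <= n)%N by rewrite -rkQ rank_leq_col.
have [P Pu PQ] : exists2 P : 'M[C]_(n - k, n), P \is unitarymx & P *m Q^t* = 0.
  have := mxrank_ker (Q^t*); rewrite mxrank_map mxrank_tr rkQ => rkK.
  rewrite -rkK; exists (schmidt (row_base (kermx (Q^t*)))).
    by rewrite schmidt_unitarymx // rank_leq_col.
  apply/sub_kermxP.
  by rewrite eqmx_schmidt_free ?row_base_free // eq_row_base.
have QP : Q *m P^t* = 0 by rewrite -[LHS]trmxCK trmxC_mul trmxCK PQ trmxC0.
exists P; split => //.
have QPu : col_mx Q P \is unitarymx.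
  apply/unitarymxP; rewrite trmxC_col mul_col_row (unitarymxP Qu).
  by rewrite (unitarymxP Pu) QP PQ -scalar_mx_block.
have := mulmxKtV 1%:M QPu (subnKC le_kn).
by rewrite trmxC_col mul1mx mul_row_col.
Qed.

(** Corresponding rows of [X] and [Y] have the same inner products, so matching them defines an
    isometry between the row spaces, which extends to a unitary map. *)
Lemma gram_eq_unitary m n (X Y : 'M[C]_(m, n)) : X *m X^t* = Y *m Y^t* ->
  exists2 V : 'M[C]_n, V \is unitarymx & Y = X *m V.
Proof.
move=> XY; set F := col_base X; set X0 := row_base X.
have FX : F *m X0 = X by exact: mulmx_base.
have /submxP [K KX] : (X0 <= X)%MS by rewrite eq_row_base.
have X0free : row_free X0 by exact: row_base_free.
(* As [F *m K] fixes [X], the Gram matrix of [(1 - F K) Y], computed with that of [X], vanishes: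
   linear relations between rows of [X] also hold in [Y]. *)
clearbody F X0; have FKY : F *m (K *m Y) = Y.
  apply/esym/eqP; rewrite -subr_eq0; apply/eqP/mul_trmxC_eq0.
  rewrite [F *m _]mulmxA -{1 3}[Y]mul1mx -mulmxBl trmxC_mul.
  rewrite mulmxA -(mulmxA _ Y) -XY mulmxA.
  by rewrite mulmxBl mul1mx -(mulmxA F) -KX FX subrr !mul0mx.
have le_rk := rank_leq_col X.
have Qu := schmidt_unitarymx X0 le_rk; set Q := schmidt X0 in Qu.
have /submxP [L LQ] : (X0 <= Q)%MS by exact: schmidt_sub.
have Lu : L \in unitmx.
  rewrite -row_free_unit -row_leq_rank -[leqLHS](eqP X0free).
  by rewrite LQ mxrankM_maxl.
(* Since [Q] is [invmx L *m (K *m X)], [Z] is its image under the isometry, and equality of the Gram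
   matrices makes its rows orthonormal. *)
pose Z := invmx L *m (K *m Y).
have Zu : Z \is unitarymx.
  apply/unitarymxP; rewrite /Z !trmxC_mul !mulmxA.
  rewrite -(mulmxA _ Y) -XY mulmxA -(mulmxA _ K) -KX.
  rewrite -(mulmxA _ (X^t*)) -trmxC_mul -KX LQ mulKmx // trmxC_mul mulmxA.
  by rewrite (unitarymxP Qu) mul1mx -trmxC_mul mulVmx // trmxC1.
have LZ : L *m Z = K *m Y by rewrite /Z mulKVmx.
(* Q and Z are orthonormal bases of the row spaces of X and Y; V maps one to the
   other and complements to complements. *)
clearbody Z; have [Q' [/unitarymxP Q'1 QQ' QQ]] := unitarymx_complement Qu.
have [Z' [/unitarymxP Z'1 ZZ' ZZ]] := unitarymx_complement Zu.
have Q'Q : Q' *m Q^t* = 0 by rewrite -[LHS]trmxCK trmxC_mul trmxCK QQ' trmxC0.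
have Z'Z : Z' *m Z^t* = 0 by rewrite -[LHS]trmxCK trmxC_mul trmxCK ZZ' trmxC0.
exists (Q^t* *m Z + Q'^t* *m Z').
  apply/unitarymxP; rewrite trmxCD !trmxC_mul !trmxCK mulmxDl !mulmxDr !mulmxA.
  rewrite -!(mulmxA _ Z) -!(mulmxA _ Z') (unitarymxP Zu) Z'1 ZZ' Z'Z.
  by rewrite !(mulmx0, mul0mx, mulmx1, addr0, add0r).
rewrite -{1}FX LQ -!mulmxA !mulmxDr !mulmxA -!(mulmxA _ Q) (unitarymxP Qu) QQ'.
rewrite !(mulmx0, mul0mx, mulmx1, addr0) -!mulmxA.
by rewrite LZ FKY.
Qed.

(** The conditions on [W1] and [W2] say that the rows of [[W1 W2]] are an orthonormal basis of a
    Lagrangian subspace. *)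
Lemma selfadjoint_pair_factor m n (N1 N2 : 'M[C]_(m, n)) :
    N1 *m N2^t* = N2 *m N1^t* ->
  exists X (W1 W2 : 'M[C]_n),
    [/\ W1 *m W1^t* + W2 *m W2^t* = 1%:M, W1 *m W2^t* = W2 *m W1^t*,
        N1 = X *m W1 & N2 = X *m W2].
Proof.
move=> N12; pose X := N1 + 'i *: N2; pose Y := N1 - 'i *: N2.
have [|V /unitarymxP VV YE] := @gram_eq_unitary _ _ X Y.
  rewrite /X /Y !trmxCD trmxCN trmxCZ conjCi !(mulmxDl, mulmxDr).
  rewrite !(mulNmx, mulmxN) -!scalemxAl -!scalemxAr N12 !scaleNr !scalerN.
  by rewrite !opprK addrA subrK addrA addrK.
pose c : C := 2^-1; have cC : c^* = c by rewrite geC0_conj // invr_ge0 ler0n.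
have i2 : 'i * 'i = -1 :> C by rewrite -expr2 sqrCi.
have N1E : N1 = c *: (X + Y) by apply/matrixP=> i j; rewrite !mxE /c; field.
have N2E : N2 = - ('i * c) *: (X - Y).
  apply/matrixP=> i j; rewrite !mxE.
  transitivity (- ('i * 'i) * N2 i j); first by rewrite i2; ring.
  by rewrite /c; field.
(* These solve [W1 + i W2 = 1] and [W1 - i W2 = V]. *)
exists X, (c *: (1%:M + V)), (- ('i * c) *: (1%:M - V)).
clearbody X Y; subst Y; split; last 2 first.
- by rewrite N1E -scalemxAr mulmxDr mulmx1.
- by rewrite N2E -scalemxAr mulmxBr mulmx1.
- rewrite !trmxCZ trmxCD trmxCD trmxCN trmxC1 rmorphN rmorphM /= conjCi cC.
  rewrite -!scalemxAl -!scalemxAr !scalerA !(mulmxDl, mulmxDr) !mul1mx !mulmx1.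
  rewrite !(mulNmx, mulmxN) VV opprK !mulNr mulrN opprK mulrN mulrACA i2.
  by apply/matrixP=> i j; rewrite !mxE /c; field.
- rewrite !trmxCZ trmxCD trmxCD trmxCN trmxC1 rmorphN rmorphM /= conjCi cC.
  rewrite -!scalemxAl -!scalemxAr !scalerA !(mulmxDl, mulmxDr) !mul1mx !mulmx1.
  rewrite !(mulNmx, mulmxN) VV.
  by apply/matrixP=> i j; rewrite !mxE; ring.
Qed.

End ConjugateTranspose.

(** * The form [J], its adjoint, and the normal form common to both properties *)

Section NormalForm.
Variables (C : numClosedFieldType) (n : nat).

(* Jmx and star are, up to conversion, the case C := R[i] of sympJ and adj. *)
Definition sympJ : 'M[C]_(n + n) := block_mx 0 1%:M (- 1%:M) 0.
Local Notation J := sympJ.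

Definition adj (X : 'M[C]_(n + n)) : 'M[C]_(n + n) := invmx J *m X^t* *m J.

Lemma trmxC_J : J^t* = - J.
Proof.
by rewrite /sympJ trmxC_block !trmxC0 trmxCN !trmxC1 opp_block_mx !oppr0 opprK.
Qed.

Lemma mulmx_JJ : J *m J = - 1%:M.
Proof.
rewrite /sympJ mulmx_block !(mulmx0, mul0mx, mulmx1, mul1mx, addr0, add0r).
by rewrite (scalar_mx_block n n) opp_block_mx !oppr0.
Qed.

Lemma invmx_J : invmx J = - J.
Proof.
have JJ : J *m - J = 1%:M by rewrite mulmxN mulmx_JJ opprK.
have [Ju _] := mulmx1_unit JJ.
by rewrite -[RHS](mulKmx Ju) JJ mulmx1.
Qed.

Lemma adjE (X : 'M[C]_(n + n)) : adj X = - (J *m X^t* *m J).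
Proof. by rewrite /adj invmx_J !mulNmx. Qed.

Lemma adj_block (A B D E : 'M[C]_n) :
  adj (block_mx A B D E) = block_mx (E^t*) (- B^t*) (- D^t*) (A^t*).
Proof.
rewrite adjE trmxC_block /sympJ !mulmx_block.
rewrite !(mulmx0, mul0mx, mulmx1, mul1mx, mulNmx, mulmxN, addr0, add0r).
by rewrite opp_block_mx !opprK.
Qed.

(* A unitary symplectic matrix commutes with J, so conjugation by it commutes
   with the adjoint. *)
Lemma adj_conj (U X : 'M[C]_(n + n)) :
    U \is unitarymx -> U *m J *m U^t* = J ->
  adj (U^t* *m X *m U) = U^t* *m adj X *m U.
Proof.
move=> Uu UJ; rewrite !adjE !trmxC_mul trmxCK mulmxN mulNmx !mulmxA.
have UJ1 : U *m J = J *m U by rewrite -{2}UJ (mulmxKtV _ Uu).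
have UJ2 : J *m U^t* = U^t* *m J.
  by rewrite -[in RHS]UJ !mulmxA (mulmx1C (unitarymxP Uu)) mul1mx.
by rewrite UJ2 -!mulmxA UJ1.
Qed.

(** Since [J] is unitary, [W *m J] has orthonormal rows, and isotropy of [W] makes them orthogonal
    to those of [W]. Right multiplication by [J] swaps the two blocks up to sign. *)
Lemma lagrangian_unitary (W : 'M[C]_(n, n + n)) :
    W \is unitarymx -> W *m J *m W^t* = 0 ->
  let U := col_mx W (W *m J) in U \is unitarymx /\ U *m J *m U^t* = J.
Proof.
move=> /unitarymxP W1 WJ U.
have WJH : W *m (W *m J)^t* = 0.
  by rewrite trmxC_mul trmxC_J mulNmx mulmxN mulmxA WJ oppr0.
have WJJ : W *m J *m (W *m J)^t* = 1%:M.
  rewrite trmxC_mul trmxC_J mulNmx mulmxN mulmxA -(mulmxA W) mulmx_JJ.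
  by rewrite mulmxN mulmx1 mulNmx opprK.
split; first apply/unitarymxP.
  by rewrite trmxC_col mul_col_row W1 WJH WJ WJJ -scalar_mx_block.
rewrite trmxC_col mul_col_mx mul_col_row WJ WJJ -(mulmxA W) mulmx_JJ.
by rewrite mulmxN mulmx1 !mulNmx W1 WJH oppr0.
Qed.

(* Gram-Schmidt on the first n columns of S spans an A-invariant Lagrangian
   subspace; completing it makes A block triangular, and normality kills the
   off-diagonal block. *)
Lemma symplectic_diagonalizable_normal_form (A S : 'M[C]_(n + n)) :
    A \is normalmx -> adj A = A ->
    S^t* *m J *m S = J -> is_diag_mx (invmx S *m A *m S) ->
  exists (U : 'M[C]_(n + n)) (a : 'M[C]_n),
    [/\ U \is unitarymx, U *m J *m U^t* = J, a \is normalmx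
      & A = U^t* *m block_mx a 0 0 (a^t*) *m U].
Proof.
move=> An As SJ.
have Su : S \in unitmx.
  have : - J *m S^t* *m J *m S = 1%:M.
    by rewrite -!mulmxA (mulmxA _ J) SJ mulNmx mulmx_JJ opprK.
  by case/mulmx1_unit.
set D := invmx S *m A *m S => Ddiag.
have AS : A *m S = S *m D by rewrite /D !mulmxA mulmxV // mul1mx.
clearbody D; pose S1 := lsubmx S.
have SE : S = row_mx S1 (rsubmx S) by rewrite hsubmxK.
have S1J : S1^t* *m J *m S1 = 0.
  move: SJ; rewrite SE trmxC_row mul_col_mx mul_col_row /sympJ.
  by case/eq_block_mx.
have AS1 : A *m S1 = S1 *m ulsubmx D.
  move: Ddiag; rewrite -[D in is_diag_mx D]submxK is_diag_block_mx //.
  case/and4P=> _ /eqP Ddl _ _; move: AS.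
  rewrite SE -{1}[D]submxK Ddl mul_mx_row mul_row_block mulmx0 addr0.
  by case/eq_row_mx.
(* The upper half of [invmx S] is a left inverse of [S1]. *)
have S1free : row_free (S1^t*).
  apply/row_freeP; exists ((usubmx (invmx S))^t*).
  rewrite -trmxC_mul -trmxC1; congr (_^t*).
  have := mulVmx Su; rewrite {2}SE -[invmx S]vsubmxK mul_col_row scalar_mx_block.
  by rewrite vsubmxK; case/eq_block_mx.
have le_n : (n <= n + n)%N by rewrite leq_addr.
have Qu := schmidt_unitarymx (S1^t*) le_n.
have /submxP [L LQ] := schmidt_sub (S1^t*).
set Q := schmidt _ in Qu LQ.
have Lu : L \in unitmx.
  rewrite -row_free_unit -row_leq_rank -[leqLHS](eqP S1free).
  by rewrite LQ mxrankM_maxl.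
have QE : Q = invmx L *m S1^t* by rewrite LQ mulKmx.
have QtE : Q^t* = S1 *m (invmx L)^t* by rewrite QE trmxC_mul trmxCK.
have QJ : Q *m J *m Q^t* = 0.
  rewrite QtE {1}QE !mulmxA -(mulmxA _ _ J) -(mulmxA _ _ S1) S1J.
  by rewrite mulmx0 mul0mx.
have AQ : A *m Q^t* = Q^t* *m (L^t* *m ulsubmx D *m (invmx L)^t*).
  have QL : Q^t* *m L^t* = S1 by rewrite -trmxC_mul -LQ trmxCK.
  by rewrite !mulmxA QL -AS1 QtE mulmxA.
have [Uu UJ] := lagrangian_unitary Qu QJ.
set U := col_mx _ _ in Uu UJ.
have Uu' : U^t* \is unitarymx by rewrite trmxC_unitary.
pose B := U *m A *m U^t*.
have BE : U^t* *m B *m U = A by exact: unitarymx_conjK.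
have Bn : B \is normalmx by exact: normalmx_conj.
have Bs : adj B = B.
  rewrite -[LHS](unitarymx_conjK _ Uu') -[RHS](unitarymx_conjK _ Uu') trmxCK.
  by rewrite -adj_conj // BE As.
(* This block is [Q J A Q^H]; by invariance it is [Q J Q^H] times a matrix. *)
have Bdl : dlsubmx B = 0.
  rewrite /B /U trmxC_col -mulmxA mul_mx_row mul_col_row block_mxKdl.
  by rewrite AQ mulmxA QJ mul0mx.
move: Bn Bs BE; rewrite -[B]submxK Bdl => Bn.
have B0 := normalmx_block_trig Bn; rewrite B0 in Bn *.
(* For a block diagonal matrix, self-adjointness makes the second block the conjugate transpose of
   the first. *)
rewrite adj_block => /eq_block_mx [_ _ _ BdrE]; rewrite -BdrE => BE.
exists U, (ulsubmx B); split=> //.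
by move: Bn; rewrite normalmx_block_diag => /andP[].
Qed.

(* N J N^H = 0 says that the row space of N is isotropic, so it lies in a
   Lagrangian subspace; normality then makes N block diagonal. *)
Lemma star_decomposition_normal_form (N : 'M[C]_(n + n)) :
    N \is normalmx -> N *m adj N = 0 ->
  exists (U : 'M[C]_(n + n)) (a : 'M[C]_n),
    [/\ U \is unitarymx, U *m J *m U^t* = J, a \is normalmx
      & N = U^t* *m block_mx a 0 0 0 *m U].
Proof.
move=> Nn; rewrite adjE mulmxN !mulmxA => NJ.
have {}NJ : N *m J *m N^t* = 0.
  move/(congr1 (fun X => X *m J)): NJ.
  by rewrite mulNmx mul0mx -mulmxA mulmx_JJ mulmxN mulmx1 opprK.
have rowJ m (P Q : 'M[C]_(m, n)) : row_mx P Q *m J = row_mx (- Q) P.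
  by rewrite mul_row_block !mulmx0 mulmxN !mulmx1 addr0 add0r.
have [|X [W1 [W2 [W12 W21 N1E N2E]]]] :=
    @selfadjoint_pair_factor _ _ _ (lsubmx N) (rsubmx N).
  move: NJ; rewrite -{1 2}[N]hsubmxK rowJ trmxC_row mul_row_col mulNmx addrC.
  by move/eqP; rewrite subr_eq0 => /eqP.
pose W := row_mx W1 W2.
have NE : N = X *m W by rewrite mul_mx_row -N1E -N2E hsubmxK.
have Wu : W \is unitarymx by apply/unitarymxP; rewrite trmxC_row mul_row_col.
have WJ : W *m J *m W^t* = 0.
  by rewrite rowJ trmxC_row mul_row_col mulNmx W21 addNr.
have [Uu UJ] := lagrangian_unitary Wu WJ.
set U := col_mx _ _ in Uu UJ.
have WU : W = row_mx 1%:M 0 *m U by rewrite mul_row_col mul1mx mul0mx addr0.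
pose B := U *m N *m U^t*.
have BE : U^t* *m B *m U = N by exact: unitarymx_conjK.
have Bn : B \is normalmx by exact: normalmx_conj.
(* The right half vanishes because [W *m U^t*] is [[1 0]]. *)
have Br : B = row_mx (U *m X) 0.
  by rewrite /B NE WU !mulmxA (mulmxtVK _ Uu) mul_mx_row mulmx1 mulmx0.
move: Bn BE; rewrite Br -[U *m X]vsubmxK -(col_mx0 _ n n) -block_mxEh => Bn.
(* With [c] the lower left block, the lower right block of the normality equation reads
   [c c^H = 0]. *)
have c0 : dsubmx (U *m X) = 0.
  move/normalmxP: Bn; rewrite trmxC_block !trmxC0 !mulmx_block !(mulmx0, mul0mx).
  by rewrite !addr0 => /eq_block_mx [_ _ _ /mul_trmxC_eq0].
rewrite c0 in Bn * => BE; exists U, (usubmx (U *m X)); split=> //.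
by move: Bn; rewrite normalmx_block_diag => /andP[].
Qed.

(** A unitary [V] diagonalizing [a] also diagonalizes [a^t*], and [diag(V, V)] is both unitary and
    symplectic. *)
Lemma normal_form_symplectic_diagonalizable (U : 'M[C]_(n + n)) (a : 'M[C]_n) :
    U \is unitarymx -> U *m J *m U^t* = J -> a \is normalmx ->
  exists S : 'M[C]_(n + n), S^t* *m J *m S = J /\
    is_diag_mx (invmx S *m (U^t* *m block_mx a 0 0 (a^t*) *m U) *m S).
Proof.
move=> Uu UJ /orthomx_spectralP; set V := spectralmx a.
have Vu : V \is unitarymx by exact: spectral_unitarymx.
rewrite invmx_unitary // => aE; clearbody V.
have aV : V *m a *m V^t* = diag_mx (spectral_diag a).
  by rewrite {1}aE !mulmxA (unitarymxP Vu) mul1mx (mulmxtVK _ Vu).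
pose T := block_mx V 0 0 V *m U.
have VVu : block_mx V 0 0 V \is unitarymx.
  apply/unitarymxP; rewrite trmxC_block !trmxC0 mulmx_block.
  by rewrite !(mulmx0, mul0mx, addr0, add0r) (unitarymxP Vu) -scalar_mx_block.
have Tu : T \is unitarymx by exact: mul_unitarymx.
exists (T^t*); split.
  rewrite trmxCK trmxC_mul !mulmxA -(mulmxA _ U) -(mulmxA _ (U *m J)) UJ.
  rewrite trmxC_block !trmxC0.
  rewrite /sympJ !mulmx_block !(mulmx0, mul0mx, addr0, add0r, mulmx1, mul1mx).
  by rewrite mulmxN mulmx1 mulNmx (unitarymxP Vu).
rewrite invmx_unitary ?trmxC_unitary // trmxCK trmxC_mul !mulmxA.
rewrite !(mulmxtVK _ Uu) trmxC_block !trmxC0 !mulmx_block.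
rewrite !(mulmx0, mul0mx, addr0, add0r) aV.
have -> : V *m a^t* *m V^t* = (diag_mx (spectral_diag a))^t*.
  by rewrite -aV !trmxC_mul trmxCK mulmxA.
rewrite is_diag_block_mx // eqxx diag_mx_is_diag tr_diag_mx map_diag_mx.
by rewrite diag_mx_is_diag.
Qed.

Theorem normal_selfadjoint_diagonalizableP (A : 'M[C]_(n + n)) :
  (A \is normalmx /\ adj A = A /\
     exists S, S^t* *m J *m S = J /\ is_diag_mx (invmx S *m A *m S)) <->
  (exists N, N \is normalmx /\ N *m adj N = 0 /\ adj N *m N = 0 /\
     A = N + adj N).
Proof.
split=> [[An [As [S [SJ Sdiag]]]]|[N [Nn [NadjN [_ ->]]]]].
  have [U [a [Uu UJ an AE]]] :=
    symplectic_diagonalizable_normal_form An As SJ Sdiag.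
  have conjM X Y : U^t* *m X *m U *m (U^t* *m Y *m U) = U^t* *m (X *m Y) *m U.
    by rewrite !mulmxA (mulmxtVK _ Uu).
  (* The adjoint of this witness is [U^H diag(0, a^H) U], supported on the complementary block. *)
  exists (U^t* *m block_mx a 0 0 0 *m U).
  rewrite adj_conj // adj_block !trmxC0 oppr0 !conjM !mulmx_block.
  rewrite !(mulmx0, mul0mx, addr0) block_mx0 mulmx0 mul0mx -mulmxDl -mulmxDr.
  rewrite add_block_mx !(addr0, add0r); split=> //.
  have := @normalmx_conj _ _ (U^t*) (block_mx a 0 0 0).
  rewrite trmxCK trmxC_unitary normalmx_block_diag an; apply=> //.
  by apply/normalmxP; rewrite mul0mx trmxC0 mulmx0.
have [U [a [Uu UJ an NE]]] := star_decomposition_normal_form Nn NadjN.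
have AE : N + adj N = U^t* *m block_mx a 0 0 (a^t*) *m U.
  rewrite NE adj_conj // adj_block !trmxC0 oppr0 -mulmxDl -mulmxDr.
  by rewrite add_block_mx !(addr0, add0r).
rewrite AE; split; last split.
- have := @normalmx_conj _ _ (U^t*) (block_mx a 0 0 (a^t*)).
  rewrite trmxCK trmxC_unitary normalmx_block_diag an; apply=> //.
  by apply/normalmxP; rewrite trmxCK (normalmxP an).
- by rewrite adj_conj // adj_block trmxCK !trmxC0 oppr0.
- exact: normal_form_symplectic_diagonalizable.
Qed.

End NormalForm.

Local Open Scope complex_scope.

Theorem theorem5 (R : realType) (n : nat) (A : 'M[R[i]]_(n + n)) :
  (A \is normalmx /\ skew_hamiltonian A /\ symplectic_diagonalizable A) <->
  (exists N : 'M[R[i]]_(n + n),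
     N \is normalmx /\
     N *m star N = 0 /\ star N *m N = 0 /\
     A = N + star N).
Proof. exact: normal_selfadjoint_diagonalizableP. Qed.
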